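(* For $n\ge 1$, the number $s_n^1(1234)$ of partial permutations of length $n$ with exactly one hole that avoid $1234$ equals $\binom{2n-2}{n-1}$.
   Context: A partial permutation of length $n$ with one hole is a sequence $\pi_1\cdots\pi_n$ in which each of $1,\dots,n-1$ appears exactly once and the remaining entry is a hole symbol $\diamond$. A permutation $\sigma$ of $[n]$ is an extension of $\pi$ if the standardization (order-preserving relabeling by $1,2,\dots$) of the restriction of $\sigma$ to the non-hole positions equals the restriction of $\pi$ to those positions. $\pi$ avoids a pattern $p$ if every extension of $\pi$ avoids $p$ in the classical sense. *)

(* Defs.v *)
From mathcomp Require Import all_boot.

Set Implicit Arguments.
Unset Strict Implicit.
Unset Printing Implicit Defensive.

(* Replaces each entry by its rank (starting from 1); this is the
   order-preserving relabeling when the entries of s are pairwise distinct. *)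
Definition standardization (s : seq nat) : seq nat :=
  [seq count (fun y => y <= x) s | x <- s].

(* The masks select exactly the subsequences of s. *)
Definition contains (p s : seq nat) : bool :=
  [exists m : (size s).-tuple bool, standardization (mask m s) == p].

(* Permutations of [n] in one-line notation. *)
Definition perms (n : nat) : seq (seq nat) := permutations (iota 1 n).

(* The hole is None.  The predecessor is meaningful only for n >= 1, since a
   sequence of length 0 has no entry for the hole. *)
Definition partial_perms1 (n : nat) : seq (seq (option nat)) :=
  permutations (None :: [seq Some v | v <- iota 1 n.-1]).

Definition is_extension (pi : seq (option nat)) (sigma : seq nat) : bool :=
  (sigma \in perms (size pi))
  && (standardization (mask [seq isSome x | x <- pi] sigma) == pmap id pi).

Definition partial_avoids (p : seq nat) (pi : seq (option nat)) : bool :=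
  all (fun sigma => is_extension pi sigma ==> ~~ contains p sigma)
      (perms (size pi)).

(* A cardinality, as permutations never lists the same sequence twice
   (permutations_uniq). *)
Definition s1 (n : nat) (p : seq nat) : nat :=
  size [seq pi <- partial_perms1 n | partial_avoids p pi].

(* Main.v *)
(* Deleting the hole turns a partial permutation avoiding 12...(k+1) into a
   permutation avoiding 12...k, wherever the hole is: an increasing subsequence
   of length k can be lengthened through the hole by choosing the value there.
   Hence the count is n times the number of 123-avoiding permutations of [n-1].
   The latter are generated by inserting a new maximum, which creates no 123
   exactly when it is placed inside or at the ends of the initial decreasing
   run.  A run of length k thus yields children with runs 1, ..., k+1, and the
   numbers of descendants are the ballot numbers. *)
Require Import Defs.
From mathcomp Require Import all_boot zify.

Set Implicit Arguments.
Unset Strict Implicit.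
Unset Printing Implicit Defensive.

(** * Standardization and increasing patterns *)

Lemma size_standardization s : size (standardization s) = size s.
Proof. exact: size_map. Qed.

Lemma standardization_sorted t :
  sorted ltn t -> standardization t = iota 1 (size t).
Proof.
elim: t => [//|x t IHt] /=; rewrite (path_sortedE ltn_trans) => /andP[ltx st].
rewrite /standardization /= leqnn.
have -> : count (leq^~ x) t = 0.
  apply/eqP; rewrite -leqn0 leqNgt -has_count -all_predC.
  by apply: sub_all ltx => y /=; rewrite ltnNge.
rewrite addn0 -[iota 2 _]/(iota (1 + 1) _) iotaDl -IHt // -map_comp; congr (_ :: _).
by apply/eq_in_map => z zt /=; rewrite (ltnW (allP ltx z zt)).
Qed.

Lemma count_leq_homo (s : seq nat) x y :
  x <= y -> count (leq^~ x) s <= count (leq^~ y) s.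
Proof. by move=> lexy; apply: sub_count => z /leq_trans; apply. Qed.

Lemma count_leq_strict_homo (s : seq nat) x y :
  y \in s -> x < y -> count (leq^~ x) s < count (leq^~ y) s.
Proof.
elim: s => [//|z s IHs]; rewrite inE /= => /orP[/eqP<- ltxy|ys ltxy].
  by rewrite leqnn (leqNgt y x) ltxy ltnS count_leq_homo // ltnW.
by have := IHs ys ltxy; case: (leqP z x); case: (leqP z y); lia.
Qed.

(** Ranks depend weakly monotonically on values, so a strict increase of ranks forces a strict
    increase of values. *)
Lemma standardizationP t :
  reflect (sorted ltn t) (standardization t == iota 1 (size t)).
Proof.
apply: (iffP eqP) => [std|/standardization_sorted//].
have: sorted ltn (standardization t) by rewrite std iota_ltn_sorted.
rewrite sorted_map; apply: sub_sorted => x y /=.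
by apply: contraTT; rewrite -!leqNgt; apply: count_leq_homo.
Qed.

Lemma standardization_perm_iota t n :
  perm_eq t (iota 1 n) -> standardization t = t.
Proof.
move=> pt; rewrite -[RHS]map_id; apply/eq_in_map => x.
rewrite (perm_mem pt) mem_iota => /andP[x_gt0 ltxn].
(* Cut [iota 1 n] after [x]: all of the first piece is counted, none of the second. *)
rewrite (permP pt) -(@subnKC x n) ?iotaD ?count_cat; last by lia.
rewrite (@eq_in_count _ _ predT) ?count_predT ?size_iota.
  rewrite (@eq_in_count _ _ pred0) ?count_pred0 ?addn0 // => y.
  by rewrite mem_iota /= => Hy; apply/negbTE; lia.
by move=> y; rewrite mem_iota /= => Hy; lia.
Qed.

(** A longer increasing subsequence can be truncated, so the bound [k <= size t] suffices and later
    proofs need no exact length. *)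
Lemma contains_iotaP k s :
  reflect (exists t, [/\ sorted ltn t, subseq t s & k <= size t])
          (contains (iota 1 k) s).
Proof.
apply: (iffP existsP) => [[m /eqP std]|[t [st ts kt]]].
  have sz : k = size (mask m s).
    by have := size_standardization (mask m s); rewrite std size_iota.
  exists (mask m s); split; rewrite ?mask_subseq -?sz //.
  by apply/standardizationP; rewrite -sz std.
have /subseqP[m szm tm] : subseq (take k t) s.
  exact: subseq_trans (take_subseq _ _) ts.
have szm' : size m == size s by rewrite szm.
exists (Tuple szm') => /=; rewrite -tm.
have {2}-> : k = size (take k t) by rewrite size_takel.
exact/standardizationP/take_sorted.
Qed.

Lemma contains_iota_standardization k s :
  contains (iota 1 k) s -> contains (iota 1 k) (standardization s).
Proof.
case/contains_iotaP => t [st ts kt]; apply/contains_iotaP.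
exists [seq count (leq^~ x) s | x <- t]; split; last by rewrite size_map.
  apply: (homo_sorted_in (P := mem s)) st => [x y xs ys /= ltxy|].
    exact: count_leq_strict_homo.
  by apply/allP => x /(mem_subseq ts).
exact: map_subseq.
Qed.

Lemma contains_iota_subseq k s1 s2 :
  subseq s1 s2 -> contains (iota 1 k) s1 -> contains (iota 1 k) s2.
Proof.
move=> s12 /contains_iotaP[t [st ts1 kt]]; apply/contains_iotaP.
by exists t; split=> //; apply: subseq_trans s12.
Qed.

(** * Deleting and filling the hole *)

Lemma subseq_cat_split (T : eqType) (t a b : seq T) :
  subseq t (a ++ b) ->
  exists t1 t2, [/\ t = t1 ++ t2, subseq t1 a & subseq t2 b].
Proof.
case/subseqP => m; rewrite size_cat => szm ->.
exists (mask (take (size a) m) a), (mask (drop (size a) m) b).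
split; rewrite ?mask_subseq // -mask_cat ?cat_take_drop // size_takel //.
by rewrite szm leq_addr.
Qed.

(** Split the subsequence at the deleted position. Only the first entry of its right part can be the
    one matched with [v], so dropping that entry loses at most one. *)
Lemma contains_iota_delete k v a b :
  contains (iota 1 k.+1) (a ++ v :: b) -> contains (iota 1 k) (a ++ b).
Proof.
case/contains_iotaP => t [st /subseq_cat_split[t1 [t2 [Et t1a t2b]]] kt].
rewrite {t}Et in st kt.
apply/contains_iotaP; exists (t1 ++ behead t2); split.
- apply: (subseq_sorted ltn_trans) st; rewrite subseq_cat2l.
  by case: t2 {t2b kt} => //= x t2; apply: subseq_cons.
- apply: cat_subseq t1a _; case: t2 t2b {st kt} => [|x t2] /=.
    by rewrite sub0seq.
  by case: eqP => // _; apply: subseq_trans (subseq_cons _ _).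
- by move: kt; rewrite !size_cat size_behead; case: (size t2) => /=; lia.
Qed.

Lemma path_ltn_last x t : path ltn x t -> all (leq^~ (last x t)) (x :: t).
Proof.
elim: t x => [|y t IHt] x /=; first by rewrite leqnn.
case/andP => ltxy /IHt /= /andP[ley ->]; rewrite ley !andbT.
exact: leq_trans (ltnW ltxy) ley.
Qed.

(* A new entry just above the last element of the increasing subsequence that
   precedes the hole extends the subsequence. *)
Lemma contains_iota_insert k a b n :
  perm_eq (a ++ b) (iota 1 n) -> contains (iota 1 k) (a ++ b) ->
  exists2 v, 0 < v <= n.+1 &
    contains (iota 1 k.+1) (map (bump v) a ++ v :: map (bump v) b).
Proof.
move=> pab /contains_iotaP[t [st /subseq_cat_split[t1 [t2 [Et t1a t2b]]] kt]].
rewrite {t}Et in st kt.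
have bnd x : x \in a ++ b -> 0 < x <= n by rewrite (perm_mem pab) mem_iota.
have l1n : last 0 t1 <= n.
  case: t1 t1a {st kt} => //= x t1 t1a.
  suff /bnd/andP[] : last x t1 \in a ++ b by [].
  by rewrite mem_cat (mem_subseq t1a) // mem_last.
(* All entries are positive, so prepending 0 keeps the sequence increasing and gives [last 0 t1] the
   right meaning when [t1] is empty. *)
have: path ltn 0 (t1 ++ t2).
  rewrite path_sortedE; [|exact: ltn_trans]; rewrite st andbT.
  by apply/allP => x /(mem_subseq (cat_subseq t1a t2b))/bnd/andP[].
rewrite cat_path => /andP[p1 p2]; set l := last 0 t1 in l1n p2.
exists l.+1; first by rewrite /= ltnS.
(* Entries of [t1] are at most [l] and stay fixed; those of [t2] exceed [l] and move up by one,
   leaving [l.+1] free in between. *)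
have E1 : map (bump l.+1) t1 = t1.
  rewrite -[RHS]map_id; apply/eq_in_map => x xt1.
  have /= /allP/(_ x xt1) := path_ltn_last p1.
  by rewrite -/l /bump => lexl; rewrite ltnNge lexl.
have E2 : map (bump l.+1) t2 = map S t2.
  apply/eq_in_map => x xt2.
  move: p2; rewrite path_sortedE; last exact: ltn_trans.
  by case/andP => /allP/(_ x xt2) /= lx _; rewrite /bump lx.
apply/contains_iotaP; exists (t1 ++ l.+1 :: map S t2); split.
- suff: path ltn 0 (t1 ++ l.+1 :: map S t2) by apply: path_sorted.
  by rewrite cat_path p1 /= -/l ltnSn path_map.
- rewrite -E1 -E2; apply: cat_subseq; first exact: map_subseq.
  by rewrite /= eqxx; apply: map_subseq.
- by move: kt; rewrite !size_cat /= size_map addnS.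
Qed.

Lemma mask_isSome_hole (T : eqType) (a b a' b' : seq T) v :
  size a' = size a -> size b' = size b ->
  mask [seq isSome x | x <- map some a ++ None :: map some b] (a' ++ v :: b')
  = a' ++ b'.
Proof.
move=> sa sb; rewrite map_cat /= -!map_comp mask_cat ?size_map //.
have tt (s : seq T) : [seq isSome (Some i) | i <- s] = nseq (size s) true.
  by elim: s => //= x s ->.
by rewrite /= !tt -sa -sb !mask_true.
Qed.

Lemma partial_avoids_iota k (a b : seq nat) n :
  perm_eq (a ++ b) (iota 1 n) ->
  partial_avoids (iota 1 k.+1) (map some a ++ None :: map some b)
  = ~~ contains (iota 1 k) (a ++ b).
Proof.
move=> pab; set pi := map some a ++ _.
have szab : size a + size b = n.
  by rewrite -size_cat (perm_size pab) size_iota.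
have szpi : size pi = n.+1 by rewrite size_cat /= !size_map addnS szab.
have pmapE : pmap id pi = a ++ b.
  by rewrite pmap_cat /= !(@map_pK _ _ id some (fun=> erefl)).
apply/allP/idP => [av|nab s sp].
  apply/negP => /(contains_iota_insert pab)[v /andP[v_gt0 lev] cv].
  set s := _ ++ _ in cv.
  have sz_s : size s = n.+1 by rewrite size_cat /= !size_map addnS szab.
  have ps : perm_eq s (iota 1 n.+1).
    have us : uniq s.
      rewrite (perm_uniq (_ : perm_eq _ (v :: map (bump v) (a ++ b)))); last first.
        by rewrite map_cat; apply: permEl (perm_catCA _ [:: v] _).
      rewrite /= map_inj_uniq ?(perm_uniq pab) ?iota_uniq ?andbT.
        by apply/mapP => -[x _]; rewrite /bump; case: leqP => /=; lia.
      by move=> x y; rewrite /bump; do 2!case: leqP => /=; lia.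
    have ss : {subset s <= iota 1 n.+1}.
      have bnd x : x \in a ++ b -> bump v x \in iota 1 n.+1.
        rewrite (perm_mem pab) !mem_iota /bump; case: leqP => /=; lia.
      move=> x; rewrite mem_cat inE => /or3P[/mapP[y ya ->]|/eqP->|/mapP[y yb ->]].
      - by apply: bnd; rewrite mem_cat ya.
      - by rewrite mem_iota; lia.
      - by apply: bnd; rewrite mem_cat yb orbT.
    have [|_ eqs] := uniq_min_size us ss; first by rewrite sz_s size_iota.
    by apply: uniq_perm => //; apply: iota_uniq.
  have := av s; rewrite /perms szpi mem_permutations => /(_ ps).
  rewrite cv implybF /is_extension szpi /perms mem_permutations ps /=.
  rewrite mask_isSome_hole ?size_map // pmapE -map_cat => /negP; apply.
  (* [bump v] preserves order, so ranks are the same before and after it. *)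
  rewrite -{2}(standardization_perm_iota pab) /standardization -map_comp.
  apply/eqP/eq_in_map => x _ /=; rewrite count_map.
  by apply: eq_count => y /=; rewrite leq_bump2.
apply/implyP => /andP[_ /eqP ext]; apply: contra nab => cs.
move: sp ext; rewrite szpi /perms mem_permutations => /perm_size.
rewrite size_iota => sz_s.
have lt_as : size a < size s by rewrite sz_s ltnS -szab leq_addr.
(* The default 0 is never reached, by [lt_as]. *)
have Es : s = take (size a) s ++ nth 0 s (size a) :: drop (size a).+1 s.
  by rewrite -drop_nth ?cat_take_drop.
rewrite pmapE Es mask_isSome_hole => [<-||].
- apply: contains_iota_standardization.
  by apply: (@contains_iota_delete _ (nth 0 s (size a))); rewrite -Es.
- by rewrite size_takel // ltnW.
- by rewrite size_drop sz_s -szab subSS addKn.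
Qed.

(** * Permutations by insertion of one entry *)

Definition insert_at (T : Type) i (x : T) s := take i s ++ x :: drop i s.

Lemma permutations_cons (T : eqType) (x : T) s : x \notin s ->
  perm_eq (permutations (x :: s))
    [seq insert_at i x t | t <- permutations s, i <- iota 0 (size t).+1].
Proof.
move=> xs.
have pi i t : perm_eq (insert_at i x t) (x :: t).
  by rewrite /insert_at -(cat1s x (drop i t)) perm_catCA cat_take_drop.
apply: uniq_perm; first exact: permutations_uniq.
  apply: allpairs_uniq_dep; first exact: permutations_uniq.
    by move=> t _; apply: iota_uniq.
  move=> p q /allpairsPdep[t [i [tp ip ->]]] /allpairsPdep[u [j [up jp ->]]] /=.
  (* As [x] does not occur in [r], [index] and [rem] recover the position and the rest; hence
     distinct insertions give distinct results. *)
  have xt r m : r \in permutations s -> m \in iota 0 (size r).+1 ->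
      (index x (insert_at m x r) = m) /\ (rem x (insert_at m x r) = r).
    rewrite mem_permutations mem_iota => pr Hm.
    have xr : x \notin r by rewrite (perm_mem pr).
    have xtk : x \notin take m r by apply: contra xr => /mem_take.
    have sz : size (take m r) = m by rewrite size_takel //; lia.
    have idx : index x (insert_at m x r) = m.
      by rewrite /insert_at index_cat (negbTE xtk) /= eqxx addn0.
    split=> //; rewrite remE idx /insert_at take_size_cat // -cat_rcons.
    by rewrite drop_size_cat ?size_rcons ?sz // cat_take_drop.
  have [ti tr] := xt _ _ tp ip; have [ui ur] := xt _ _ up jp.
  move=> E; have Et : t = u by rewrite -tr E ur.
  by have Ei : i = j by [rewrite -ti E ui]; rewrite Et Ei.
move=> r; rewrite mem_permutations; apply/idP/allpairsPdep.
  move=> pr; have xr : x \in r by rewrite (perm_mem pr) mem_head.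
  have ir : index x r < size r by rewrite index_mem.
  exists (rem x r), (index x r); rewrite mem_permutations mem_iota size_rem //.
  split; [|by lia|].
    by rewrite -(perm_cons x) -(permPl (perm_to_rem xr)).
  rewrite /insert_at remE take_cat drop_cat size_takel ?ltnn ?subnn ?take0 ?drop0; last by lia.
  by rewrite cats0 -{2}(nth_index x xr) -drop_nth // cat_take_drop.
case=> t [i []]; rewrite mem_permutations => pt _ ->.
by rewrite (permPl (pi _ _)) perm_cons.
Qed.

(** * Initial decreasing runs and insertion of a maximum *)

Fixpoint descent_run (s : seq nat) : nat :=
  if s is x :: s' then
    if s' is y :: _ then if y < x then (descent_run s').+1 else 1 else 1
  else 0.

Lemma descent_run_size s : descent_run s <= size s.
Proof. by elim: s => [//|x [//|y s] IHs] /=; case: ifP => _ //; apply: IHs. Qed.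

Lemma sorted_take_descent_run s j :
  j <= size s -> sorted gtn (take j s) = (j <= descent_run s).
Proof.
elim: s j => [|x [|y s] IHs] [|[|j]] //= jn.
- by case: (y < x).
- by have /= -> := IHs j.+1 jn; case: (y < x).
Qed.

(** In front, [N] lengthens the run by one. At a later position within the run or at its end, the
    ascent to [N] stops the run after the [j] entries before it. *)
Lemma descent_run_insert N s j :
  all (gtn N) s -> j <= descent_run s ->
  descent_run (insert_at j N s)
  = if j == 0 then (descent_run s).+1 else j.
Proof.
elim: s j => [|x [|y s] IHs] [|[|j]] //=; try lia.
- by case/andP => ->.
- by case/andP => xN _ _; rewrite ltnNge ltnW.
- by case/and3P => ->.
- by case/and3P => xN _ _ _; rewrite ltnNge ltnW.
case/andP => _ sN; case: (ltnP y x) => // ltyx jd.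
by have /= := IHs j.+1 sN jd; rewrite ?ltyx => ->.
Qed.

(** A maximum can only be the last entry of an increasing subsequence; the entries before it then
    all come from [a]. *)
Lemma contains_iota_max k N a b : all (gtn N) (a ++ b) ->
  contains (iota 1 k.+1) (a ++ N :: b)
  = contains (iota 1 k.+1) (a ++ b) || contains (iota 1 k) a.
Proof.
rewrite all_cat => /andP[aN bN]; apply/idP/orP; last first.
  case; first exact/contains_iota_subseq/cat_subseq/subseq_cons.
  case/contains_iotaP => t [st ta kt]; apply/contains_iotaP.
  exists (rcons t N); split; last by rewrite size_rcons.
    rewrite sorted_pairwise ?pairwise_rcons -?sorted_pairwise ?st ?andbT;
      try exact: ltn_trans.
    by apply/allP => x /(mem_subseq ta); apply: (allP aN).
  by rewrite -cats1; apply: cat_subseq ta _; rewrite /= eqxx sub0seq.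
case/contains_iotaP => t [st /subseq_cat_split[t1 [t2 [Et t1a t2b]]] kt].
subst t.
case: t2 st kt t2b => [|y t2] st kt.
  move=> _; left; apply/contains_iotaP; exists t1.
  by rewrite cats0 in st kt; split=> //; exact: subseq_trans t1a (prefix_subseq _ _).
rewrite [subseq _ _]/=; case: eqP => [Ey|_] t2b; last first.
  by left; apply/contains_iotaP; exists (t1 ++ y :: t2); rewrite cat_subseq.
right; apply/contains_iotaP; exists t1; split=> //.
  exact: (subseq_sorted ltn_trans (prefix_subseq _ _) st).
(* An entry chosen after [N] would be smaller than [N], against the increase. *)
case: t2 t2b st kt => [|z t2] t2b; first by rewrite size_cat addn1.
have zN : z < N by apply: (allP bN); rewrite (mem_subseq t2b) // mem_head.
by rewrite Ey => /cat_sorted2[_] /= /andP[/ltn_trans/(_ zN)]; rewrite ltnn.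
Qed.

(** Distinctness turns a failure of decrease into a strict ascent. *)
Lemma contains12 s : uniq s -> contains (iota 1 2) s = ~~ sorted gtn s.
Proof.
move=> us; apply/idP/idP => [/contains_iotaP[[|x [|y t]] [//= /andP[ltxy _] ts _]]|].
  apply: contraL ltxy => /(subseq_sorted (rev_trans ltn_trans) ts) /=.
  by case/andP => /ltnW; rewrite leqNgt.
elim: s us => [//|x s IHs] /= /andP[xs us].
rewrite (path_sortedE (rev_trans ltn_trans)) negb_and => /orP[|/(IHs us)]; last first.
  exact/contains_iota_subseq/subseq_cons.
case/allPn => y ys; rewrite -leqNgt leq_eqVlt => /orP[/eqP Exy|ltxy].
  by rewrite Exy ys in xs.
apply/(contains_iotaP 2); exists [:: x; y]; split=> //=; first by rewrite ltxy.
by rewrite eqxx sub1seq.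
Qed.

Lemma insert_max_avoids123 m s j :
  perm_eq s (iota 1 m) -> j <= m ->
  ~~ contains (iota 1 3) (insert_at j m.+1 s)
  = ~~ contains (iota 1 3) s && (j <= descent_run s).
Proof.
move=> ps jm; have szs : size s = m by rewrite (perm_size ps) size_iota.
rewrite /insert_at contains_iota_max ?cat_take_drop; last first.
  by apply/allP => x; rewrite (perm_mem ps) mem_iota /=; lia.
rewrite negb_or contains12 ?negbK ?sorted_take_descent_run ?szs //.
by rewrite take_uniq // (perm_uniq ps) iota_uniq.
Qed.

(** * The generating tree of 123-avoiding permutations *)

(** The weight [F] is arbitrary so that the recurrence can be iterated, each round replacing a
    weight by its sum over children. *)
Lemma sum_avoids123_recr m (F : nat -> nat) :
  \sum_(s <- permutations (iota 1 m.+1) | ~~ contains (iota 1 3) s)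
     F (descent_run s)
  = \sum_(s <- permutations (iota 1 m) | ~~ contains (iota 1 3) s)
     \sum_(1 <= j < (descent_run s).+2) F j.
Proof.
rewrite (perm_big [seq insert_at i m.+1 t | t <- permutations (iota 1 m),
    i <- iota 0 (size t).+1]); last first.
  rewrite -(permPr (permutations_cons _)) ?mem_iota; last by lia.
  by apply: perm_permutations; rewrite -[iota 1 m.+1]/(iota 1 (1 + m)) addnC iotaD cats1 add1n perm_rcons.
rewrite big_mkcond big_allpairs_dep [RHS]big_mkcond big_seq [RHS]big_seq.
apply: eq_bigr => s; rewrite mem_permutations => ps.
have szs : size s = m by rewrite (perm_size ps) size_iota.
have sN : all (gtn m.+1) s.
  by apply/allP => x; rewrite (perm_mem ps) mem_iota /=; lia.
have dm : descent_run s <= m by rewrite -szs descent_run_size.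
transitivity (\sum_(0 <= j < m.+1) if ~~ contains (iota 1 3) s && (j <= descent_run s)
  then F (if j == 0 then (descent_run s).+1 else j) else 0).
  rewrite szs /index_iota subn0 big_seq [RHS]big_seq; apply: eq_bigr => j.
  rewrite mem_iota => jm; rewrite insert_max_avoids123 //.
  by case: andP => // -[_ jd]; rewrite descent_run_insert.
case: ifP => _ /=; last by rewrite big1_eq.
rewrite (big_cat_nat (n := (descent_run s).+1)) //= [X in _ + X]big_nat_cond.
rewrite [X in _ + X]big1 ?addn0; last first.
  by move=> j /andP[/andP[dj _] _]; rewrite leqNgt dj.
(* Insertion in front, [j = 0], yields the largest label and so matches the last term on the
   right. *)
rewrite big_ltn //= [RHS]big_nat_recr //= addnC; congr (_ + _).
by apply: eq_big_nat => -[//|j] /andP[_ jd]; rewrite ltnS in jd *; rewrite jd.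
Qed.

(* Nodes d levels below a node labelled k in the generating tree with rule
   k -> 1, ..., k+1. *)
Fixpoint descendants d k :=
  if d is d'.+1 then \sum_(1 <= j < k.+2) descendants d' j else 1.

Lemma card_avoids123 m :
  \sum_(s <- permutations (iota 1 m) | ~~ contains (iota 1 3) s) 1
  = descendants m 0.
Proof.
(* The induction trades permutation length for depth [d] in the tree; at [d = 0] the weight is 1.
   The root is the empty permutation, with run 0. *)
suff sumD d : \sum_(s <- permutations (iota 1 m) | ~~ contains (iota 1 3) s)
    descendants d (descent_run s) = descendants (m + d) 0.
  by rewrite -[m in RHS]addn0 -(sumD 0).
elim: m d => [|m IHm] d; last by rewrite sum_avoids123_recr addSnnS -IHm.
rewrite big_mkcond big_seq1; case: (contains_iotaP 3 [::]) => // -[t []].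
by rewrite subseq0 => _ /eqP ->.
Qed.

(** * Ballot and Catalan numbers *)

(** Raising the label from [k] to [k.+1] adds a single child, labelled [k.+2]. *)
Lemma descendants_rec d k :
  descendants d.+1 k.+1 = descendants d.+1 k + descendants d k.+2.
Proof. by rewrite /= big_nat_recr. Qed.

(* The ballot numbers 'C(2d + k, d) - 'C(2d + k, d - 1), free of subtraction. *)
Lemma descendants_bin d k :
  descendants d.+1 k + 'C(2 * d.+1 + k, d) = 'C(2 * d.+1 + k, d.+1).
Proof.
elim: d k => [|d IHd] k.
  by rewrite /= sum_nat_const_nat muln1 bin0 bin1; lia.
elim: k => [|k IHk].
  have E2 : descendants d.+2 0 = descendants d.+1 1 by rewrite /= big_nat1.
  have := IHd 1; rewrite E2 (_ : 2 * d.+2 + 0 = (2 * d.+1 + 1).+1); last by lia.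
  (* The upper index [N] is odd, so its two middle binomials, at [d.+1] and [d.+2], agree by
     symmetry. *)
  have: 2 * d.+1 + 1 = d.+1 + d.+2 by lia.
  move: (2 * d.+1 + 1) => N EN; rewrite !binS -(@bin_sub N d.+2) EN ?leq_addl //.
  by rewrite addnK; lia.
(* Both induction hypotheses have upper index [2 * d.+2 + k]; Pascal's rule adds them up. *)
rewrite descendants_rec; have := IHd k.+2.
rewrite (_ : 2 * d.+1 + k.+2 = 2 * d.+2 + k); last by lia.
by rewrite addnS; move: (2 * d.+2 + k) IHk => N; rewrite !binS; lia.
Qed.

(** These are the Catalan numbers: the ratio of neighbouring binomials turns the ballot difference
    into a quotient. *)
Lemma descendants0 m : m.+1 * descendants m 0 = 'C(2 * m, m).
Proof.
case: m => [//|m]; have := descendants_bin m 0; rewrite addn0.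
have := mul_bin_left (2 * m.+1) m.
rewrite (_ : 2 * m.+1 - m = m.+2); last by lia.
nia.
Qed.

(** * Counting partial permutations *)

Lemma permutations_map (T U : eqType) (f : T -> U) s : injective f ->
  perm_eq (permutations (map f s)) (map (map f) (permutations s)).
Proof.
move=> f_inj; apply: uniq_perm; first exact: permutations_uniq.
  by rewrite map_inj_uniq ?permutations_uniq //; apply: inj_map.
move=> t; rewrite mem_permutations; apply/idP/mapP => [pt|[u]].
  have [u Et] : exists u, t = map f u.
    have: {subset t <= map f s} by move=> y; rewrite (perm_mem pt).
    elim: t {pt} => [|y t IHt] ts; first by exists [::].
    have /mapP[x _ ->] := ts y (mem_head _ _).
    have [z zt|u ->] := IHt; first by apply: ts; rewrite inE zt orbT.
    by exists (x :: u).
  exists u => //; rewrite mem_permutations.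
  by move: pt; rewrite Et => /(perm_map_inj f_inj).
by rewrite mem_permutations => pu ->; apply: perm_map.
Qed.

Theorem theorem30 (n : nat) (hn : 1 <= n) :
  s1 n [:: 1; 2; 3; 4] = 'C(2 * n - 2, n - 1).
Proof.
case: n hn => // m _; rewrite (_ : 2 * m.+1 - 2 = 2 * m) ?subn1 /=; last by lia.
rewrite -descendants0 -card_avoids123 big_distrr /s1 -sum1_size big_filter.
have some_inj : injective (@Some nat) by move=> ? ? [].
(* Partial permutations are enumerated by inserting [None] into arrangements of the [Some]
   values. *)
rewrite (perm_big _ (permutations_cons _)); last by apply/mapP => -[].
rewrite big_mkcond big_allpairs_dep (perm_big _ (permutations_map _ some_inj)).
rewrite big_map [RHS]big_mkcond [LHS]big_seq [RHS]big_seq.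
apply: eq_bigr => u; rewrite mem_permutations => pu.
rewrite size_map (perm_size pu) size_iota -[[:: 1; 2; 3; 4]]/(iota 1 4).
(* The summand does not depend on the hole position [i], and the [m.+1] positions give the factor
   [m.+1]. *)
rewrite (eq_bigr (fun=> if ~~ contains (iota 1 3) u then 1 else 0)) => [|i _].
  by rewrite big_const_seq count_predT size_iota iter_addn_0 mulnC; case: ifP => _; rewrite /= ?muln1 ?muln0.
rewrite /insert_at -map_take -map_drop (@partial_avoids_iota 3 _ _ m).
  by rewrite cat_take_drop.
by rewrite cat_take_drop.
Qed.
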